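(* Let $X$ and $Y$ be finite nonempty sets and $F: X\to 2^Y$ a set-valued mapping. For any execution of the calculation method described in the context, the following are equivalent: (i) $F$ satisfies the Hall condition; (ii) the calculation method does not stop at Step 4; (iii) the calculation method stops at Step 7 or at Step 8, and the resulting tuple $(W_1,\ldots,W_m)$ is a Hall partition of $F$.
   Context: A set-valued mapping $F: X \to 2^Y$ assigns to each $x$ a (possibly empty) subset $F(x) \subset Y$; $F(W) = \bigcup_{x\in W}F(x)$; $\sharp$ is cardinality. $F$ satisfies the Hall condition if $\sharp F(W)\ge\sharp W$ for all $W\subset X$. For $W \subset X$, $F_W: X\setminus W \to 2^Y$ is $F_W(x) = F(x) \setminus F(W)$ (with $F_\emptyset = F$). For set-valued $G$ on a finite set, a subset $W$ of its domain is critical for $G$ if $W\ne\emptyset$ and $\sharp G(W)=\sharp W$; non-reducible for $G$ if $W\ne\emptyset$ and no proper subset of $W$ is critical for $G$. A tuple $(W_1,\ldots,W_m)$, $m\ge1$, is a Hall partition of $F$ if the $W_i$ are nonempty, pairwise disjoint with union $X$, and with $G_i = F_{W_1\cup\cdots\cup W_{i-1}}$ ($G_1=F$): (i) $G_i(x)\neq\emptyset$ for $x \in W_i$; (ii) $W_i$ is non-reducible for $G_i$; (iii) $W_i$ is critical for $G_i$ for $i \le m-1$. The calculation method: Step 1: start with $m=0$. Step 2: one has $m\ge 0$ and pairwise disjoint $W_1,\ldots,W_m\subset X$ with $W_i$ critical for $F_{W_1\cup\cdots\cup W_{i-1}}$. Step 3: choose $x \in X\setminus\bigcup_{j\le m}W_j$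 and set $W=\{x\}$. Step 4: if $\sharp F_{\bigcup_{j\le m}W_j}(W) < \sharp W$, STOP; otherwise continue. Step 5: if $W$ is a critical set of $F_{\bigcup_{j\le m}W_j}$, set $W_{m+1}=W$, increase $m$ by one, and go to Step 8; otherwise continue. Step 6: if not all nonempty subsets of $X\setminus\bigcup_{j\le m}W_j$ have yet been considered (in the current pass since Step 3), choose a new one $W'$: one of the same size as $W$ if such a not-yet-considered subset exists, otherwise one with one more element; set $W=W'$ and go to Step 4. Step 7: (all subsets considered, none critical) set $W_{m+1} = X\setminus\bigcup_{j\le m}W_j$, increase $m$ by one, and STOP. Step 8: if $\bigcup_{j\le m}W_j = X$, STOP; otherwise go to Step 2. *)

(* Defs.v *)
From mathcomp Require Import all_boot.

Set Implicit Arguments.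
Unset Strict Implicit.
Unset Printing Implicit Defensive.

(* A set-valued mapping with domain D \subset X is represented by D together
   with a total function X -> {set Y}, whose values outside D are irrelevant. *)

Definition setval (X Y : finType) (F : X -> {set Y}) (W : {set X}) : {set Y} :=
  \bigcup_(x in W) F x.

Definition hall_condition (X Y : finType) (F : X -> {set Y}) : Prop :=
  forall W : {set X}, #|W| <= #|setval F W|.

(* The mapping F_U; its domain is ~: U. *)
Definition reduced (X Y : finType) (F : X -> {set Y}) (U : {set X}) :
    X -> {set Y} :=
  fun x => F x :\: setval F U.

Definition critical (X Y : finType) (D : {set X}) (G : X -> {set Y})
    (W : {set X}) : bool :=
  [&& W \subset D, W != set0 & #|setval G W| == #|W|].

Definition non_reducible (X Y : finType) (D : {set X}) (G : X -> {set Y})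
    (W : {set X}) : bool :=
  [&& W \subset D, W != set0
    & [forall V : {set X}, (V \proper W) ==> ~~ critical D G V]].

Definition unionseq (X : finType) (Ws : seq {set X}) : {set X} :=
  \bigcup_(V <- Ws) V.

(* Tuples are indexed from 0 here: the mapping attached to the i-th set is
   F_U with U the union of the first i sets. *)
Definition hall_partition (X Y : finType) (F : X -> {set Y})
    (Ws : seq {set X}) : Prop :=
  [/\ 0 < size Ws,
      set0 \notin Ws,
      pairwise (fun A B : {set X} => [disjoint A & B]) Ws,
      unionseq Ws = [set: X]
    & forall i, i < size Ws ->
        let U := unionseq (take i Ws) in
        let W := nth set0 Ws i in
        [/\ forall x, x \in W -> reduced F U x != set0,
            non_reducible (~: U) (reduced F U) W
          & i.+1 < size Ws -> critical (~: U) (reduced F U) W]].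

(* Configurations of the calculation method: the constructor is the control
   point, Ws is (W_1, ..., W_m), C is the collection of subsets already
   considered in the current pass since Step 3, and W is the current subset. *)
Inductive config (X : finType) : Type :=
  | Step1
  | Step2 (Ws : seq {set X})
  | Step3 (Ws : seq {set X})
  | Step4 (Ws : seq {set X}) (C : {set {set X}}) (W : {set X})
  | Step5 (Ws : seq {set X}) (C : {set {set X}}) (W : {set X})
  | Step6 (Ws : seq {set X}) (C : {set {set X}}) (W : {set X})
  | Step7 (Ws : seq {set X})
  | Step8 (Ws : seq {set X})
  | StopAt4 (Ws : seq {set X})
  | StopAt7 (Ws : seq {set X})
  | StopAt8 (Ws : seq {set X}).

Arguments Step1 {X}.

Definition unconsidered (X : finType) (Ws : seq {set X}) (C : {set {set X}}) :
    {set {set X}} :=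
  [set V : {set X} | [&& V != set0, V \subset ~: unionseq Ws & V \notin C]].

(* Step 2 only records an invariant of the loop and performs no test, so its
   transition is unconditional. *)
Inductive step (X Y : finType) (F : X -> {set Y}) :
    config X -> config X -> Prop :=
  | step_1 :
      step F Step1 (Step2 [::])
  | step_2 Ws :
      step F (Step2 Ws) (Step3 Ws)
  | step_3 Ws x of x \notin unionseq Ws :
      step F (Step3 Ws) (Step4 Ws [set [set x]] [set x])
  | step_4_stop (Ws : seq {set X}) (C : {set {set X}}) (W : {set X})
      of #|setval (reduced F (unionseq Ws)) W| < #|W| :
      step F (Step4 Ws C W) (StopAt4 Ws)
  | step_4_continue (Ws : seq {set X}) (C : {set {set X}}) (W : {set X})
      of ~~ (#|setval (reduced F (unionseq Ws)) W| < #|W|) :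
      step F (Step4 Ws C W) (Step5 Ws C W)
  | step_5_critical (Ws : seq {set X}) (C : {set {set X}}) (W : {set X})
      of critical (~: unionseq Ws) (reduced F (unionseq Ws)) W :
      step F (Step5 Ws C W) (Step8 (rcons Ws W))
  | step_5_continue (Ws : seq {set X}) (C : {set {set X}}) (W : {set X})
      of ~~ critical (~: unionseq Ws) (reduced F (unionseq Ws)) W :
      step F (Step5 Ws C W) (Step6 Ws C W)
  | step_6_same_size (Ws : seq {set X}) (C : {set {set X}}) (W W' : {set X})
      of W' \in unconsidered Ws C & #|W'| = #|W| :
      step F (Step6 Ws C W) (Step4 Ws (W' |: C) W')
  | step_6_next_size (Ws : seq {set X}) (C : {set {set X}}) (W W' : {set X})
      of (forall V, V \in unconsidered Ws C -> #|V| <> #|W|)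
       & W' \in unconsidered Ws C & #|W'| = #|W|.+1 :
      step F (Step6 Ws C W) (Step4 Ws (W' |: C) W')
  | step_6_exhausted (Ws : seq {set X}) (C : {set {set X}}) (W : {set X})
      of unconsidered Ws C = set0 :
      step F (Step6 Ws C W) (Step7 Ws)
  | step_7 Ws :
      step F (Step7 Ws) (StopAt7 (rcons Ws (~: unionseq Ws)))
  | step_8_stop Ws of unionseq Ws = [set: X] :
      step F (Step8 Ws) (StopAt8 Ws)
  | step_8_loop Ws of unionseq Ws <> [set: X] :
      step F (Step8 Ws) (Step2 Ws).

(* A maximal run of the method.  Termination is not built in: the run is
   indexed by nat, and it is constant from a configuration on only when that
   configuration has no successor. *)
Definition execution (X Y : finType) (F : X -> {set Y})
    (run : nat -> config X) : Prop :=
  run 0 = Step1 /\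
  forall n, step F (run n) (run n.+1) \/
            (forall c, ~ step F (run n) c) /\ run n.+1 = run n.

Definition stops_at_step4 (X : finType) (run : nat -> config X) : Prop :=
  exists n Ws, run n = StopAt4 Ws.

Definition stops_at_step7_with (X : finType) (run : nat -> config X)
    (Ws : seq {set X}) : Prop :=
  exists n, run n = StopAt7 Ws.

Definition stops_at_step8_with (X : finType) (run : nat -> config X)
    (Ws : seq {set X}) : Prop :=
  exists n, run n = StopAt8 Ws.

(* Main.v *)
Require Import Defs.
From mathcomp Require Import all_boot zify.

Set Implicit Arguments.
Unset Strict Implicit.
Unset Printing Implicit Defensive.

(** A run terminates because every step decreases a natural number that encodes
    lexicographically the number of elements of X not yet covered, the number
    of subsets not yet considered, and the control point.  A pass considers
    subsets by increasing size, so the first critical set that it meets is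
    non-reducible: a run that does not stop at Step 4 builds a Hall partition.
    Everything else rests on #F(U u W) = #F(U) + #F_U(W).  Summed over the
    critical blocks it gives #F(U) = #U for their union U, so that a stop at
    Step 4 contradicts the Hall condition for U u W.  Conversely, it reduces the
    Hall condition for F to the Hall condition for F_U on each block, where a
    minimal violating set minus one point would be critical. *)

Section SetValued.
Variables (X Y : finType).
Implicit Types (F G : X -> {set Y}) (U V W : {set X}) (Ws : seq {set X}).
Implicit Types (C : {set {set X}}).

(** * Cardinality of the values on a union *)

Lemma setval1 F x : setval F [set x] = F x.
Proof. exact: big_set1. Qed.

Lemma setvalS F V W : V \subset W -> setval F V \subset setval F W.
Proof.
move=> sVW; apply/bigcupsP => x Vx; apply: bigcup_sup.
exact: (subsetP sVW).
Qed.

Lemma setval_reduced F U W :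
  setval (reduced F U) W = setval F W :\: setval F U.
Proof.
apply/setP => y; rewrite inE; apply/bigcupP/andP.
  by case=> x Wx /setDP[Fxy FUy]; split=> //; apply/bigcupP; exists x.
by case=> FUy /bigcupP[x Wx Fxy]; exists x => //; rewrite inE FUy.
Qed.

Lemma card_setvalU F U W :
  #|setval F (U :|: W)| = #|setval F U| + #|setval (reduced F U) W|.
Proof.
rewrite setval_reduced /setval bigcup_setU -/(setval F U) -/(setval F W).
by rewrite -(cardsID (setval F U) (_ :|: _)) setUK setDUl setDv set0U.
Qed.

Lemma leq_card_setval_reducedS F U V W : V \subset U ->
  #|setval (reduced F U) W| <= #|setval (reduced F V) W|.
Proof.
by move=> sVU; rewrite !setval_reduced subset_leq_card// setDS// setvalS.
Qed.

Lemma unionseq_rcons Ws W : unionseq (rcons Ws W) = unionseq Ws :|: W.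
Proof. by rewrite /unionseq -cats1 big_cat big_seq1. Qed.

Lemma sub_unionseq Ws W : W \in Ws -> W \subset unionseq Ws.
Proof. by rewrite /unionseq bigcup_seq => WsW; apply: (bigcup_sup W). Qed.

Lemma card_setUC U W : W \subset ~: U -> #|U :|: W| = #|U| + #|W|.
Proof.
rewrite -disjoints_subset disjoint_sym cardsU => /disjoint_setI0.
by move->; rewrite cards0 subn0.
Qed.

(** * Hall partitions, block by block *)

Lemma non_reducible_hall D G W : non_reducible D G W ->
  (forall x, x \in W -> G x != set0) ->
  forall V, V \subset W -> #|V| <= #|setval G V|.
Proof.
case/and3P=> sWD _ /forallP redW GW V.
have [n] := ubnP #|V|; elim: n V => // n IHn V ltVn sVW.
have [->|[x Vx]] := set_0Vmem V; first by rewrite cards0.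
have cV := cardsD1 x V; rewrite Vx in cV.
have sV'W : V :\ x \subset W by rewrite (subset_trans (subsetDl _ _)).
have {}IHn : #|V :\ x| <= #|setval G (V :\ x)| by apply: IHn => //; lia.
have leV : #|setval G (V :\ x)| <= #|setval G V|.
  by rewrite subset_leq_card// setvalS// subsetDl.
(* The empty set is never critical, so a singleton [V] relies on [G x] being nonempty instead. *)
have [V'0|V'n0] := eqVneq (V :\ x) set0.
  have := GW x (subsetP sVW x Vx); rewrite -card_gt0 -setval1.
  have -> : [set x] = V by rewrite -(setD1K Vx) V'0 setU0.
  by rewrite V'0 cards0 in cV; lia.
have := redW (V :\ x).
rewrite (proper_sub_trans (properD1 Vx) sVW) /critical (subset_trans sV'W)//=.
by rewrite V'n0 /=; lia.
Qed.

(** The bound [k] is kept apart from [size Ws]: during a run all blocks are critical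
    ([k = size Ws]), whereas the last block of a Hall partition need not be ([k = (size Ws).-1]). *)
Definition hall_blocks F k Ws : Prop :=
  forall i, i < size Ws ->
    let U := unionseq (take i Ws) in
    let W := nth set0 Ws i in
    [/\ forall x, x \in W -> reduced F U x != set0,
        non_reducible (~: U) (reduced F U) W
      & i < k -> critical (~: U) (reduced F U) W].

Lemma hall_blocks_rcons F k Ws W (U := unionseq Ws) :
  hall_blocks F (size Ws) Ws ->
  (forall x, x \in W -> reduced F U x != set0) ->
  non_reducible (~: U) (reduced F U) W ->
  (size Ws < k -> critical (~: U) (reduced F U) W) ->
  hall_blocks F k (rcons Ws W).
Proof.
move=> hWs nz nr cr i; rewrite size_rcons ltnS leq_eqVlt => /predU1P[->|lti] /=.
  by rewrite nth_rcons ltnn eqxx -cats1 take_size_cat.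
have [nzi nri cri] := hWs i lti.
rewrite nth_rcons lti -cats1 takel_cat ?(ltnW lti)//.
by split=> // _; apply: cri.
Qed.

Lemma hall_blocks_partition F Ws : 0 < #|X| -> unionseq Ws = [set: X] ->
  hall_blocks F (size Ws).-1 Ws -> hall_partition F Ws.
Proof.
move=> X0 UWs hWs; split=> //.
- case: Ws UWs {hWs} => // UWs.
  by move: X0; rewrite -cardsT -UWs /unionseq big_nil cards0.
- apply/(nthP set0) => -[i /hWs[_ /and3P[_ W0 _] _] eqW].
  by rewrite eqW eqxx in W0.
- apply/(pairwiseP set0) => i j; rewrite !inE => lti ltj ltij.
  have [_ /and3P[sWU _ _] _] := hWs j ltj.
  rewrite disjoint_sym disjoints_subset (subset_trans sWU)// setCS.
  apply: sub_unionseq; rewrite -(nth_take set0 ltij) mem_nth//.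
  by rewrite size_take ltj.
by move=> i /hWs; rewrite ltn_predRL.
Qed.

(** For the block added at Step 7: strictness on singletons gives nonempty values, and strictness
    everywhere excludes critical subsets. *)
Lemma hall_blocks_rcons_setC F Ws (U := unionseq Ws) : 0 < #|X| ->
  hall_blocks F (size Ws) Ws -> U != [set: X] ->
  (forall V, V != set0 -> V \subset ~: U ->
     #|V| < #|setval (reduced F U) V|) ->
  hall_partition F (rcons Ws (~: U)).
Proof.
move=> X0 hWs UT ltV.
apply: hall_blocks_partition => //; first by rewrite unionseq_rcons setUCr.
rewrite size_rcons /=; apply: hall_blocks_rcons; rewrite ?ltnn// -/U.
- move=> x Ux; rewrite -card_gt0 -setval1.
  apply: ltn_trans (ltV [set x] _ _); rewrite ?cards1 ?sub1set//.
  by rewrite -card_gt0 cards1.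
- apply/and3P; split=> //; first by rewrite -setCT (inj_eq (@setC_inj X)).
  apply/forallP => V; apply/implyP => /proper_sub sVU.
  apply/and3P => -[_ V0 /eqP cV].
  by have := ltV V V0 sVU; rewrite cV ltnn.
Qed.

(** For the block added at Step 5: strictness is assumed only below the size of [W], which is all
    that a pass by increasing size provides. *)
Lemma hall_blocks_rcons_critical F Ws W k (U := unionseq Ws) :
  hall_blocks F (size Ws) Ws -> critical (~: U) (reduced F U) W ->
  (forall V, V != set0 -> V \subset ~: U -> #|V| < #|W| ->
     #|V| < #|setval (reduced F U) V|) ->
  hall_blocks F k (rcons Ws W).
Proof.
move=> hWs crW ltV; have /and3P[sWU W0 /eqP cW] := crW.
apply: hall_blocks_rcons => //.
- move=> x Wx; rewrite -card_gt0 -setval1.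
  (* When [W] is a singleton, strictness does not apply to it; criticality gives the nonempty
     value. *)
  have [xW|] := eqVneq [set x] W; first by rewrite xW cW card_gt0.
  rewrite eqEcard sub1set Wx cards1 -ltnNge => ltW.
  apply: ltn_trans (ltV [set x] _ _ _); rewrite ?cards1 ?sub1set//.
    by rewrite -card_gt0 cards1.
  exact: (subsetP sWU).
- rewrite /non_reducible sWU W0; apply/forallP => V; apply/implyP => pVW.
  apply/and3P => -[sVU V0 /eqP cV].
  by have := ltV V V0 sVU (proper_card pVW); rewrite cV ltnn.
Qed.

Lemma card_setval_blocks F Ws : hall_blocks F (size Ws) Ws ->
  #|setval F (unionseq Ws)| = #|unionseq Ws|.
Proof.
move=> hWs; rewrite -(take_size Ws); move: (leqnn (size Ws)).
(* Induction on the length of a prefix; the occurrence of [size Ws] left out stays as its upper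
   bound. *)
elim: {1 3 4}(size Ws) => [|i IHi] lti.
  by rewrite take0 /unionseq /setval !big_nil big_set0 !cards0.
have [_ _ /(_ lti) /and3P[sWU _ /eqP cW]] := hWs i lti.
rewrite (take_nth set0 lti) unionseq_rcons card_setvalU card_setUC// cW.
by rewrite IHi// ltnW.
Qed.

(** Let U be the union of a prefix and V the next block. Passing from W :&: U to W :&: (U :|: V)
    adds the values of W :&: V outside F(W :&: U). They include those outside F(U), and
    non-reducibility of V makes these at least as many as the points of W :&: V. *)
Lemma hall_partition_hall F Ws : hall_partition F Ws -> hall_condition F.
Proof.
case=> _ _ _ UWs hWs W.
have {UWs}-> : W = W :&: unionseq (take (size Ws) Ws).
  by rewrite take_size UWs setIT.
move: (leqnn (size Ws)); elim: {1 3 4}(size Ws) => [|i IHi] lti.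
  by rewrite take0 /unionseq big_nil setI0 cards0.
have [nz nr _] := hWs i lti; move: (IHi (ltnW lti)).
rewrite (take_nth set0 lti) unionseq_rcons setIUr card_setvalU.
set U := unionseq _ in nz nr *; set V := nth set0 Ws i in nz nr *.
have := non_reducible_hall nr nz (subsetIr W V).
have := leq_card_setval_reducedS F (W :&: V) (subsetIr W U).
rewrite cardsU; lia.
Qed.

(** * Termination *)

(* M bounds the contribution of everything but the number of uncovered elements:
   4 * #|unconsidered Ws C| + 8 < M.-2. *)
Definition measure (c : config X) : nat :=
  let M := 4 * #|{set X}| + 12 in
  let todo Ws := #|~: unionseq Ws| * M in
  let pass Ws C := todo Ws + 4 * #|unconsidered Ws C| in
  match c with
  | Step1 => todo [::] + M
  | Step2 Ws => todo Ws + M.-1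
  | Step3 Ws => todo Ws + M.-2
  | Step4 Ws C _ => pass Ws C + 8
  | Step5 Ws C _ => pass Ws C + 7
  | Step6 Ws C _ => pass Ws C + 6
  | Step7 Ws => todo Ws + 1
  | Step8 Ws => todo Ws + M
  | _ => 0
  end.

Lemma card_unconsideredU1 Ws C W :
  W \in unconsidered Ws C ->
  #|unconsidered Ws (W |: C)| < #|unconsidered Ws C|.
Proof.
move=> uW; apply: proper_card; apply/properP; split; last first.
  by exists W => //; rewrite !inE eqxx /= !andbF.
by apply/subsetP => V; rewrite !inE negb_or => /and3P[-> -> /andP[]].
Qed.

Lemma step_measure F c c' : step F c c' -> measure c' < measure c.
Proof.
have leu Ws C : #|unconsidered Ws C| <= #|{set X}| by apply: max_card.
case=> {c c'} /=; try by move=> *; lia.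
- move=> Ws x _; have := leu Ws [set [set x]].
  set u := #|unconsidered _ _|; lia.
- move=> Ws C W /and3P[sWU W0 _].
  rewrite unionseq_rcons -card_gt0 in W0 *.
  have := cardsC (unionseq Ws); have := cardsC (unionseq Ws :|: W).
  by rewrite card_setUC//; nia.
(* Going back from Step 6 to Step 4 costs 2, and considering a new set gains at least 4. *)
- move=> Ws C W W' /card_unconsideredU1 + _.
  set u' := #|unconsidered _ _|; set u := #|unconsidered _ C|; lia.
- move=> Ws C W W' _ /card_unconsideredU1 + _.
  set u' := #|unconsidered _ _|; set u := #|unconsidered _ C|; lia.
Qed.

(** * Invariant and progress *)

(** The two size bounds express the order of the pass. [W] is exempt from strictness because it may
    still be under test. *)
Definition pass_invariant F Ws C W : Prop :=
  let G := reduced F (unionseq Ws) in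
  [/\ W != set0, W \subset ~: unionseq Ws,
      forall V, V \in unconsidered Ws C -> #|W| <= #|V|,
      forall V, V \in C -> #|V| <= #|W|
    & forall V, V \in C -> V != W -> #|V| < #|setval G V|].

(** [StopAt4] no longer carries the current set, so the violating set is kept as an existential. In
    Steps 4 to 6, [W] itself shows that some point is uncovered. *)
Definition invariant F (c : config X) : Prop :=
  let blocks Ws := hall_blocks F (size Ws) Ws in
  let open Ws := blocks Ws /\ unionseq Ws != [set: X] in
  let G Ws := setval (reduced F (unionseq Ws)) in
  match c with
  | Step1 => True
  | Step2 Ws | Step3 Ws => open Ws
  | Step4 Ws C W => blocks Ws /\ pass_invariant F Ws C W
  | Step5 Ws C W => [/\ blocks Ws, pass_invariant F Ws C W & #|W| <= #|G Ws W|]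
  | Step6 Ws C W => [/\ blocks Ws, pass_invariant F Ws C W & #|W| < #|G Ws W|]
  | Step7 Ws => open Ws /\
      forall V, V != set0 -> V \subset ~: unionseq Ws -> #|V| < #|G Ws V|
  | Step8 Ws => blocks Ws
  | StopAt4 Ws => blocks Ws /\
      exists2 W : {set X}, W \subset ~: unionseq Ws & #|G Ws W| < #|W|
  | StopAt7 Ws | StopAt8 Ws => hall_partition F Ws
  end.

Lemma pass_invariant_next F Ws C W W' :
  pass_invariant F Ws C W -> #|W| < #|setval (reduced F (unionseq Ws)) W| ->
  W' \in unconsidered Ws C -> #|W| <= #|W'| ->
  (forall V, V \in unconsidered Ws C -> #|W'| <= #|V|) ->
  pass_invariant F Ws (W' |: C) W'.
Proof.
move=> [_ _ _ CW ltC] ltW uW' leW minW'.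
have := uW'; rewrite inE => /and3P[W'0 sW'U W'C]; split=> //.
- move=> V; rewrite !inE negb_or => /and3P[V0 sVU /andP[_ VC]].
  by apply: minW'; rewrite inE V0 sVU.
- by move=> V /setU1P[->//|/CW]; lia.
- move=> V /setU1P[->|VC _]; first by rewrite eqxx.
  by have [->//|/(ltC _ VC)] := eqVneq V W.
Qed.

Lemma step_invariant F c c' : 0 < #|X| ->
  step F c c' -> invariant F c -> invariant F c'.
Proof.
move=> X0; case=> {c c'} /=.
- move=> _; split; first by [].
  by rewrite /unionseq big_nil eq_sym -card_gt0 cardsT.
- by [].
- move=> Ws x Ux [hWs _]; split=> //; split.
  + by rewrite -card_gt0 cards1.
  + by rewrite sub1set inE.
  + by move=> V; rewrite inE cards1 card_gt0 => /andP[].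
  + by move=> V /set1P->.
  + by move=> V /set1P->; rewrite eqxx.
- by move=> Ws C W ltW [hWs [_ sWU _ _ _]]; split=> //; exists W.
- by move=> Ws C W; rewrite -leqNgt => leW [].
- move=> Ws C W crW [hWs [W0 sWU minW CW ltC] _].
  rewrite size_rcons; apply: hall_blocks_rcons_critical => // V V0 sVU ltVW.
  (* [V] must have been considered already: unconsidered sets are at least as large as [W]. *)
  have [VC|VC] := boolP (V \in C).
    by apply: ltC => //; apply: contraTneq ltVW => ->; rewrite ltnn.
  by have := minW V; rewrite inE V0 sVU VC => /(_ isT); lia.
- move=> Ws C W ncr [hWs pW leW]; split=> //; case: pW => W0 sWU _ _ _.
  by rewrite ltn_neqAle leW andbT eq_sym; move: ncr; rewrite /critical sWU W0.
- move=> Ws C W W' uW' cW' [hWs pW ltW]; split=> //.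
  apply: pass_invariant_next (pW) ltW uW' _ _; rewrite cW'//.
  by case: pW.
- move=> Ws C W W' nu uW' cW' [hWs pW ltW]; split=> //.
  apply: pass_invariant_next (pW) ltW uW' _ _; rewrite cW'//.
  case: pW => _ _ minW _ _ V uV; have := minW V uV; have := nu V uV; lia.
- move=> Ws C W u0 [hWs [W0 sWU _ _ ltC] ltW]; split; first split=> //.
    by apply: contraNneq W0 => UT; rewrite UT setCT subset0 in sWU.
  move=> V V0 sVU; have : V \notin unconsidered Ws C by rewrite u0 inE.
  rewrite inE V0 sVU negbK => VC.
  by have [->//|/(ltC _ VC)] := eqVneq V W.
- by move=> Ws [[hWs UT] ltV]; apply: hall_blocks_rcons_setC.
- move=> Ws UT hWs; apply: hall_blocks_partition => // i /hWs[nz nr cr].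
  by split=> // lti; apply: cr; lia.
- by move=> Ws /eqP UT hWs.
Qed.

(** The invariant prevents deadlock at Step 3, by an uncovered point, and at Step 6, by a set of
    exactly the next size. *)
Lemma step_progress F c : invariant F c ->
  (exists c', step F c c') \/
  exists Ws, [\/ c = StopAt4 Ws, c = StopAt7 Ws | c = StopAt8 Ws].
Proof.
case: c => [|Ws|Ws|Ws C W|Ws C W|Ws C W|Ws|Ws|Ws|Ws|Ws] /= inv;
  try by right; exists Ws; constructor.
- by left; eexists; constructor.
- by left; eexists; constructor.
- left; case: inv => _; rewrite -subTset => /subsetPn[x _ Ux].
  by eexists; apply: step_3 Ux.
- left; case: (boolP (#|setval (reduced F (unionseq Ws)) W| < #|W|)) => h.
    by eexists; apply: step_4_stop.
  by eexists; apply: step_4_continue.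
- left; case: (boolP (critical (~: unionseq Ws) (reduced F (unionseq Ws)) W)).
    by eexists; apply: step_5_critical.
  by eexists; apply: step_5_continue.
- left; case: inv => _ [_ _ minW CW _] _.
  have [u0|[V uV]] := set_0Vmem (unconsidered Ws C).
    by eexists; apply: step_6_exhausted.
  have [W' /andP[uW' /eqP cW']|nu] :=
    pickP [pred W' | (W' \in unconsidered Ws C) && (#|W'| == #|W|)].
    by eexists; apply: step_6_same_size uW' cW'.
  have {}nu W' : W' \in unconsidered Ws C -> #|W'| <> #|W|.
    by move=> uW' /eqP cW'; have := nu W'; rewrite /= uW' cW'.
  (* [V] is larger than [W], and a subset of it with one element more than [W] is too large to be in
     [C]. *)
  have /card_geqP[s [us cs sV]] : #|W|.+1 <= #|V|.
    by have := minW V uV; have := nu V uV; lia.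
  have cW' : #|[set x in s]| = #|W|.+1 by rewrite cardsE (card_uniqP us).
  eexists; apply: (@step_6_next_size _ _ _ Ws C W [set x in s]) => //.
  move: uV; rewrite !inE => /and3P[_ sVU _].
  rewrite -card_gt0 cW' (subset_trans _ sVU) /=; last first.
    by apply/subsetP => x; rewrite inE => /sV.
  by apply/negP => /CW; rewrite cW' ltnn.
- by left; eexists; constructor.
- left; case: (eqVneq (unionseq Ws) [set: X]) => [UT|/eqP UT].
    by eexists; apply: step_8_stop.
  by eexists; apply: step_8_loop.
Qed.

(** * Maximal runs *)

Lemma execution_invariant F run n : 0 < #|X| ->
  execution F run -> invariant F (run n).
Proof.
move=> X0 [run0 runS]; elim: n => [|n IHn]; first by rewrite run0.
by case: (runS n) => [st|[_ ->//]]; apply: step_invariant st IHn.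
Qed.

Lemma execution_halts F run : execution F run ->
  exists n, forall c, ~ step F (run n) c.
Proof.
case=> _ runS; suff H m : forall n, measure (run n) < m ->
    exists n, forall c, ~ step F (run n) c by exact: (H _ 0 (ltnSn _)).
elim: m => // m IHm n ltm.
case: (runS n) => [st|[stuck _]]; last by exists n.
by apply: (IHm n.+1); have := step_measure st; lia.
Qed.

End SetValued.

Theorem theorem8p1 (X Y : finType) (hX : 0 < #|X|) (hY : 0 < #|Y|)
    (F : X -> {set Y}) (run : nat -> config X) (hrun : execution F run) :
  [<-> hall_condition F;
       ~ stops_at_step4 run;
       exists2 Ws : seq {set X},
         stops_at_step7_with run Ws \/ stops_at_step8_with run Ws
         & hall_partition F Ws].
Proof.
tfae.
- move=> hF [n [Ws runn]]; have := execution_invariant n hX hrun.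
  rewrite runn /= => -[hWs [W sWU ltW]]; have := hF (unionseq Ws :|: W).
  by rewrite card_setvalU card_setUC// card_setval_blocks//; lia.
- move=> no4; have [n stuck] := execution_halts hrun.
  have invn := execution_invariant n hX hrun.
  (* A configuration without successor is one of the three stops. *)
  have [[c /stuck//]|[Ws [runn|runn|runn]]] := step_progress invn.
  + by case: no4; exists n, Ws.
  + by exists Ws; [left; exists n | rewrite runn in invn].
  + by exists Ws; [right; exists n | rewrite runn in invn].
- by case=> Ws _; apply: hall_partition_hall.
Qed.
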